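(* Let $b\ge 1$ and $k\ge 0$ be integers, let $p$ be a prime not dividing $b$, and let $n_b(k,p)=(b^k-k)(p-1)-k$, assumed to be a positive integer. Then $p$ divides $C_b(n_b(k,p))$, where $C_b(n):=nb^n+1$.
   Context: The integers $C_b(n) = nb^n+1$, with $b$ and $n$ positive integers, are called Generalized Cullen Numbers. *)

(* Defs.v *)
From mathcomp Require Import all_boot all_order all_algebra.

Set Implicit Arguments.
Unset Strict Implicit.
Unset Printing Implicit Defensive.

Import GRing.Theory Num.Theory.

Definition gen_cullen (b n : nat) : nat := n * b ^ n + 1.

(* This lives in int because b ^ k - k and the whole expression can be negative
   (e.g. for b = 1), where truncated subtraction on nat would be wrong. *)
Definition cullen_index (b k p : nat) : int :=
  (((b ^ k)%N%:Z - k%:Z) * (p%:Z - 1) - k%:Z)%R.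

(* Main.v *)
Require Import Defs.
From mathcomp Require Import all_boot all_order all_algebra.
From mathcomp Require Import cyclic zify.

(** Write n for the index (b^k - k)(p - 1) - k and m for b^k - k. Two
    congruences modulo p determine n b^n. First, n + b^k = m p, so
    n = - b^k. Second, n + k = m (p - 1), so b^(n + k) = 1 by Fermat's little
    theorem. Hence n b^n = - b^k b^n = - 1. *)

(** Positivity of the index makes b^k - k positive, so both relations between
    the index and multiples of b^k - k can be stated in natural numbers, where
    subtraction is exact. *)
Lemma cullen_index_addn (b k p : nat) :
    prime p -> (0 < cullen_index b k p)%R ->
  `|cullen_index b k p|%N + k = (b ^ k - k) * p.-1 /\
  `|cullen_index b k p|%N + b ^ k = (b ^ k - k) * p.
Proof.
rewrite /cullen_index; move: (b ^ k)%N => c.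
case: p => [//|p] _ /=.
have -> : (p.+1%:Z - 1 = p%:Z)%R by lia.
move=> n_gt0.
have lt_kc : k < c by nia.
have [m c_def] : exists m, c = m + k by exists (c - k); lia.
have n_def : ((c%:Z - k%:Z) * p%:Z = (m * p)%:Z)%R by rewrite c_def; nia.
rewrite n_def in n_gt0 *.
by rewrite c_def addnK mulnS; lia.
Qed.

(** Fermat's little theorem, raised to the m-th power. *)
Lemma expn_mul_predp_modp (b p m : nat) :
  prime p -> ~~ (p %| b) -> b ^ (m * p.-1) = 1 %[mod p].
Proof.
move=> p_pr pNb.
have /Euler_exp_totient : coprime b p by rewrite coprime_sym prime_coprime.
rewrite totient_prime // => fermat.
by rewrite mulnC expnM -modnXm fermat modnXm exp1n.
Qed.

Theorem proposition1 (b k p : nat) (hb : 1 <= b) (hp : prime p)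
    (hpb : ~~ (p %| b)) (hn : (0 < cullen_index b k p)%R) :
  p %| gen_cullen b `|cullen_index b k p|%N.
Proof.
have [nDk nDbk] := cullen_index_addn b k p hp hn.
rewrite /gen_cullen; move: `|_|%N nDk nDbk => n nDk nDbk.
(* Modulo p the summand 1 may be replaced by b^(n + k), which makes b^n a
   common factor. *)
have -> : (p %| n * b ^ n + 1) = (p %| n * b ^ n + b ^ (n + k)).
  by rewrite /dvdn -modnDmr -(expn_mul_predp_modp b p (b ^ k - k)) // -nDk modnDmr.
by rewrite expnD [b ^ n * _]mulnC -mulnDl nDbk -mulnA dvdn_mull ?dvdn_mulr.
Qed.
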